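(* Let $Q$ be either $\mathbb R_+$ or a Lorentz cone $\mathcal L_n$ with $n\ge2$. Let $\operatorname{tan}(u,Q)$ and $\operatorname{tan}'(u,Q)$ be as defined in the context. Then for every $u\in Q$: (a) $\operatorname{tan}'(u,Q)\subseteq\operatorname{tan}(u,Q)$. (b) If $z\in\operatorname{tan}(u,Q)$ and $\gamma>0$, then $\gamma z\in\operatorname{tan}'(Mu,Q)$ for some $M>0$.
   Context: For $n\ge2$, $\mathcal L_n=\{(t,z)\in\mathbb R\times\mathbb R^{n-1}: t\ge\|z\|_2\}$. For $u\in Q$, the tangent space is $\operatorname{tan}(u,Q):=(Q\cap u^\perp)^\perp$, orthogonal complements being taken in the ambient Euclidean space. For $Q=\mathcal L_n$, index coordinates by $0,\dots,n-1$, with coordinate vectors $e_a$, and set $J=\operatorname{diag}(1,-1,\dots,-1)$, $S_{ab}=e_ae_b^T-e_be_a^T$, and $\mathcal R=\{I_n\}\cup\{S_{ab}J:0\le a<b<n\}$. For $Q=\mathbb R_+$, set $\mathcal R=\{I_1\}$. For $u\in Q$, $$\operatorname{tan}'(u,Q):=\Bigl\{z:\ u=w+\sum_{R\in\mathcal R}(v_R^++v_R^-),\ z=\sum_{R\in\mathcal R}R(v_R^+-v_R^-)\ \text{for some } w,v_R^+,v_R^-\in Q\ (R\in\mathcal R)\Bigr\}.$$ *)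

(* Defs.v *)
From HB Require Import structures.
From mathcomp Require Import all_boot all_order all_algebra.
From mathcomp Require Import finmap.
From mathcomp Require Import classical_sets reals.

Set Implicit Arguments.
Unset Strict Implicit.
Unset Printing Implicit Defensive.

Import Order.TTheory GRing.Theory Num.Theory.

Local Open Scope ring_scope.
Local Open Scope classical_set_scope.

Definition dot (R : realType) (n : nat) (x y : 'cV[R]_n) : R :=
  \sum_(i < n) x i 0 * y i 0.

(* The norm that MathComp-Analysis puts on matrices is the sup norm, hence
   this separate definition. *)
Definition norm2 (R : realType) (n : nat) (x : 'cV[R]_n) : R :=
  Num.sqrt (dot x x).

Definition orth (R : realType) (n : nat) (A : set 'cV[R]_n) : set 'cV[R]_n :=
  [set x | forall y, A y -> dot x y = 0].

Definition tan_space (R : realType) (n : nat) (Q : set 'cV[R]_n)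
    (u : 'cV[R]_n) : set 'cV[R]_n :=
  orth (Q `&` orth [set u]).

(* The families v_R^+ and v_R^- are functions of the matrix; only their values
   on the finite set Rs matter. *)
Definition tan_prime (R : realType) (n : nat) (Q : set 'cV[R]_n)
    (Rs : {fset 'M[R]_n}) (u : 'cV[R]_n) : set 'cV[R]_n :=
  [set z | exists (w : 'cV[R]_n) (vp vm : 'M[R]_n -> 'cV[R]_n),
    [/\ Q w,
        forall A, A \in Rs -> Q (vp A) /\ Q (vm A),
        u = w + \sum_(A <- Rs) (vp A + vm A) &
        z = \sum_(A <- Rs) A *m (vp A - vm A)]].

Definition nonneg_cone (R : realType) : set 'cV[R]_1 :=
  [set x | 0 <= x 0 0].

(* Lorentz cone of R^(n+1): t is the coordinate of index 0, and z consists of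
   the n remaining ones. *)
Definition lorentz_cone (R : realType) (n : nat) : set 'cV[R]_n.+1 :=
  [set x | norm2 (\col_(i < n) x (lift ord0 i) 0) <= x ord0 0].

Definition Jmx (R : realType) (n : nat) : 'M[R]_n.+1 :=
  diag_mx (\row_i (if i == ord0 then 1 else -1)).

(* delta_mx a b is e_a e_b^T. *)
Definition Smx (R : realType) (n : nat) (a b : 'I_n) : 'M[R]_n :=
  delta_mx a b - delta_mx b a.

Definition nonneg_mxs (R : realType) : {fset 'M[R]_1} := [fset 1%:M]%fset.

Definition lorentz_mxs (R : realType) (n : nat) : {fset 'M[R]_n.+1} :=
  ([fset 1%:M] `|`
   [fset Smx R p.1 p.2 *m Jmx R n
     | p in [pred p : 'I_n.+1 * 'I_n.+1 | (p.1 < p.2)%N]])%fset.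

Variant cone_with_mxs (R : realType) :
    forall n : nat, set 'cV[R]_n -> {fset 'M[R]_n} -> Prop :=
  | ConeNonneg : cone_with_mxs (@nonneg_cone R) (nonneg_mxs R)
  | ConeLorentz (n : nat) of (2 <= n.+1)%N :
      cone_with_mxs (@lorentz_cone R n) (lorentz_mxs R n).

(* Main.v *)
(** (a) The cone is self-dual, so a [y] in [Q] orthogonal to [u] is orthogonal
    to every summand of a decomposition of [u]. For the Lorentz cone, [y] and a
    summand [v] orthogonal to it satisfy [J v || y], whence
    [y . S_ab J v = y_a (J v)_b - y_b (J v)_a = 0].

    (b) The [z] lying in [tan' (M u)] for some [M > 0] form a convex cone. If [u]
    is interior, it contains every [z], using [R = I] only. If [u] is a nonzero
    boundary point of the Lorentz cone and [x = J u], then [z] is orthogonal to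
    [x], and [z = sum_(a, b) (z_a x_b / |x|^2) S_ab x] with every summand of the
    form [R (v+ - v-)] for [v+], [v-] multiples of [u]. If [u = 0], then
    [z = 0]. *)
Require Import Defs.
From HB Require Import structures.
From mathcomp Require Import all_boot all_order all_algebra.
From mathcomp Require Import finmap.
From mathcomp Require Import ring lra.
From mathcomp Require Import classical_sets reals.

Set Implicit Arguments.
Unset Strict Implicit.
Unset Printing Implicit Defensive.

Import Order.TTheory GRing.Theory Num.Theory.

Local Open Scope ring_scope.
Local Open Scope classical_set_scope.


(** * Euclidean inner product and norm *)

Lemma dotE (R : realType) (n : nat) (x y : 'cV[R]_n) :
  dot x y = (x^T *m y) 0 0.
Proof. by rewrite mxE; apply: eq_bigr => i _; rewrite mxE. Qed.

Lemma dotC (R : realType) (n : nat) (x y : 'cV[R]_n) : dot x y = dot y x.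
Proof. by apply: eq_bigr => i _; rewrite mulrC. Qed.

Lemma dotDr (R : realType) (n : nat) (x y z : 'cV[R]_n) :
  dot x (y + z) = dot x y + dot x z.
Proof. by rewrite !dotE mulmxDr mxE. Qed.

Lemma dotBr (R : realType) (n : nat) (x y z : 'cV[R]_n) :
  dot x (y - z) = dot x y - dot x z.
Proof. by rewrite !dotE mulmxBr !mxE. Qed.

Lemma dotZr (R : realType) (n : nat) (x y : 'cV[R]_n) (a : R) :
  dot x (a *: y) = a * dot x y.
Proof. by rewrite !dotE -scalemxAr mxE. Qed.

Lemma dot_sumr (R : realType) (n : nat) (I : Type) (r : seq I) (P : pred I)
    (F : I -> 'cV[R]_n) (x : 'cV[R]_n) :
  dot x (\sum_(i <- r | P i) F i) = \sum_(i <- r | P i) dot x (F i).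
Proof.
by rewrite dotE mulmx_sumr summxE; apply: eq_bigr => i _; rewrite dotE.
Qed.

Lemma dot_ge0 (R : realType) (n : nat) (x : 'cV[R]_n) : 0 <= dot x x.
Proof. by apply: sumr_ge0 => i _; rewrite -expr2 sqr_ge0. Qed.

Lemma dot_eq0 (R : realType) (n : nat) (x : 'cV[R]_n) : dot x x = 0 -> x = 0.
Proof.
move=> /eqP; rewrite psumr_eq0; last by move=> i _; rewrite -expr2 sqr_ge0.
move=> /allP x0; apply/matrixP => i j; rewrite ord1 mxE.
by have := x0 i (mem_index_enum i); rewrite /= mulf_eq0 orbb => /eqP.
Qed.

Lemma dot_delta (R : realType) (n : nat) (x : 'cV[R]_n) (a : 'I_n) :
  dot x (delta_mx a 0) = x a 0.
Proof. by rewrite dotC dotE trmx_delta -rowE mxE. Qed.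

Lemma norm2_ge0 (R : realType) (n : nat) (x : 'cV[R]_n) : 0 <= norm2 x.
Proof. exact: sqrtr_ge0. Qed.

Lemma sqr_norm2 (R : realType) (n : nat) (x : 'cV[R]_n) :
  norm2 x ^+ 2 = dot x x.
Proof. by rewrite sqr_sqrtr ?dot_ge0. Qed.

(** * Decompositions in a general convex cone *)

Definition convex_cone (R : realType) (n : nat) (Q : set 'cV[R]_n) : Prop :=
  (forall x y, Q x -> Q y -> Q (x + y)) /\
  (forall (c : R) x, 0 <= c -> Q x -> Q (c *: x)).

(** Abstract form of (a): pairing [y] with the decomposition of [u] gives a zero sum of nonnegative
    terms, so each term vanishes, and the second hypothesis carries this through [A]. *)
Lemma tan_prime_sub (R : realType) (n : nat) (Q : set 'cV[R]_n)
    (Rs : {fset 'M[R]_n}) (u : 'cV[R]_n) :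
  (forall x y, Q x -> Q y -> 0 <= dot x y) ->
  (forall A x y, A \in Rs -> Q x -> Q y -> dot y x = 0 ->
     dot y (A *m x) = 0) ->
  tan_prime Q Rs u `<=` tan_space Q u.
Proof.
move=> Qdual QRs z [w [vp [vm [Qw Qv uE ->]]]] y [Qy /(_ u erefl) yu0].
have Fge0 A : A \in Rs -> 0 <= dot y (vp A + vm A).
  by move=> /Qv[Qp Qm]; rewrite dotDr addr_ge0 ?Qdual.
move: yu0; rewrite uE dotDr dot_sumr big_seq => /eqP.
rewrite paddr_eq0 ?Qdual ?sumr_ge0// => /andP[_].
rewrite psumr_eq0// => /allP yv0.
rewrite dotC dot_sumr big_seq big1// => A ARs.
have [Qp Qm] := Qv _ ARs.
have := yv0 _ ARs; rewrite ARs /= dotDr paddr_eq0 ?Qdual//.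
move=> /andP[/eqP yp0 /eqP ym0].
rewrite mulmxBr dotBr (QRs _ _ _ ARs Qp Qy yp0).
by rewrite (QRs _ _ _ ARs Qm Qy ym0) subr0.
Qed.

(** The conclusion of (b), with [gamma] absorbed into [z]. Leaving [M] free makes it stable under
    sums: the scales add. *)
Definition tan_prime_scaled (R : realType) (n : nat) (Q : set 'cV[R]_n)
    (Rs : {fset 'M[R]_n}) (u z : 'cV[R]_n) : Prop :=
  exists M : R, 0 < M /\ tan_prime Q Rs (M *: u) z.

Lemma tan_prime_scaled0 (R : realType) (n : nat) (Q : set 'cV[R]_n)
    (Rs : {fset 'M[R]_n}) (u : 'cV[R]_n) :
  convex_cone Q -> Q u -> tan_prime_scaled Q Rs u 0.
Proof.
move=> [_ QZ] Qu; exists 1; split => //.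
have Q0 : Q 0 by rewrite -(scale0r u); exact: QZ.
exists u, (fun=> 0), (fun=> 0); split => //.
- by rewrite big1 ?scale1r ?addr0 // => A _; rewrite addr0.
- by rewrite big1 // => A _; rewrite subr0 mulmx0.
Qed.

Lemma tan_prime_scaledD (R : realType) (n : nat) (Q : set 'cV[R]_n)
    (Rs : {fset 'M[R]_n}) (u z1 z2 : 'cV[R]_n) :
  convex_cone Q -> tan_prime_scaled Q Rs u z1 -> tan_prime_scaled Q Rs u z2 ->
  tan_prime_scaled Q Rs u (z1 + z2).
Proof.
move=> [QD _] [M1 [M1_gt0 [w1 [p1 [m1 [Qw1 Qv1 uE1 ->]]]]]].
move=> [M2 [M2_gt0 [w2 [p2 [m2 [Qw2 Qv2 uE2 ->]]]]]].
exists (M1 + M2); split; first exact: addr_gt0.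
exists (w1 + w2), (fun A => p1 A + p2 A), (fun A => m1 A + m2 A); split.
- exact: QD.
- move=> A ARs; have [? ?] := Qv1 A ARs; have [? ?] := Qv2 A ARs.
  by split; apply: QD.
- rewrite scalerDl uE1 uE2 addrACA -big_split; congr (_ + _).
  by apply: eq_bigr => A _; rewrite addrACA.
- rewrite -big_split; apply: eq_bigr => A _ /=.
  by rewrite -mulmxDr opprD addrACA.
Qed.

Lemma tan_prime_scaled_mul (R : realType) (n : nat) (Q : set 'cV[R]_n)
    (Rs : {fset 'M[R]_n}) (u p m : 'cV[R]_n) (A : 'M[R]_n) (M : R) :
  convex_cone Q -> A \in Rs -> Q p -> Q m -> 0 < M -> p + m = M *: u ->
  tan_prime_scaled Q Rs u (A *m (p - m)).
Proof.
move=> [_ QZ] ARs Qp Qm M_gt0 pmE; exists M; split => //.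
have Q0 : Q 0 by rewrite -(scale0r p); exact: QZ.
(* All of [M *: u] is spent on the single matrix [A]. *)
exists 0, (fun B => if B == A then p else 0), (fun B => if B == A then m else 0).
split => //.
- by move=> B _; case: ifP.
- rewrite add0r (big_fsetD1 A) //= eqxx pmE big_seq big1 ?addr0 // => B.
  by rewrite in_fsetD1 => /andP[/negPf-> _]; rewrite addr0.
- rewrite (big_fsetD1 A) //= eqxx big_seq big1 ?addr0 // => B.
  by rewrite in_fsetD1 => /andP[/negPf-> _]; rewrite subr0 mulmx0.
Qed.

Lemma tan_prime_scaled_face (R : realType) (n : nat) (Q : set 'cV[R]_n)
    (Rs : {fset 'M[R]_n}) (u : 'cV[R]_n) (A : 'M[R]_n) (c : R) :
  convex_cone Q -> A \in Rs -> Q u -> tan_prime_scaled Q Rs u (c *: (A *m u)).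
Proof.
move=> cQ ARs Qu; have [_ QZ] := cQ.
(* Both coefficients are positive whatever the sign of [c], and they differ by [c]. *)
have -> : c *: (A *m u) = A *m ((1 + `|c| + c) *: u - (1 + `|c|) *: u).
  by rewrite -scalerBl addrC addKr -scalemxAr.
have c1 : 0 < 1 + `|c| by rewrite ltr_pwDl.
have c2 : 0 < 1 + `|c| + c.
  by rewrite -addrA ltr_pwDl// -lerBlDr sub0r -normrN ler_norm.
apply: (@tan_prime_scaled_mul _ _ _ _ _ _ _ _ (1 + `|c| + c + (1 + `|c|))) => //.
- exact/QZ/Qu/ltW.
- exact/QZ/Qu/ltW.
- exact: addr_gt0.
- by rewrite -scalerDl.
Qed.

Lemma tan_prime_scaled_interior (R : realType) (n : nat) (Q : set 'cV[R]_n)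
    (Rs : {fset 'M[R]_n}) (u z : 'cV[R]_n) (c : R) :
  convex_cone Q -> 1%:M \in Rs -> 0 < c ->
  Q (c *: u + z) -> Q (c *: u - z) -> tan_prime_scaled Q Rs u z.
Proof.
move=> cQ IRs c_gt0 Qp Qm; have [_ QZ] := cQ.
(* The halves of [c *: u + z] and [c *: u - z] differ by [z] and add up to [c *: u]. *)
have -> : z = 1%:M *m (2^-1 *: (c *: u + z) - 2^-1 *: (c *: u - z)).
  rewrite mul1mx -scalerBr opprB [z - _]addrC addrACA subrr add0r.
  by rewrite -mulr2n -scaler_nat scalerA mulVf ?scale1r ?pnatr_eq0.
apply: (@tan_prime_scaled_mul _ _ _ _ _ _ _ _ c) => //.
- by apply: QZ => //; rewrite invr_ge0 ler0n.
- by apply: QZ => //; rewrite invr_ge0 ler0n.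
- rewrite -scalerDr addrACA subrr addr0 -mulr2n -scaler_nat scalerA.
  by rewrite mulVf ?scale1r ?pnatr_eq0.
Qed.

(** * The half-line *)

Lemma nonneg_cone_convex (R : realType) : convex_cone (@nonneg_cone R).
Proof.
split => [x y|c x c0] /=; rewrite /nonneg_cone /= !mxE.
- exact: addr_ge0.
- exact: mulr_ge0.
Qed.

Lemma dot1 (R : realType) (x y : 'cV[R]_1) : dot x y = x 0 0 * y 0 0.
Proof. by rewrite /dot big_ord1. Qed.

Lemma tan_space_nonneg (R : realType) (u z : 'cV[R]_1) :
  nonneg_cone u -> tan_space (@nonneg_cone R) u z ->
  tan_prime_scaled (@nonneg_cone R) (nonneg_mxs R) u z.
Proof.
move=> Qu tz; have cQ := nonneg_cone_convex R.
have [u0|u_neq0] := eqVneq (u 0 0) 0.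
  suff -> : z = 0 by exact: tan_prime_scaled0.
  apply/matrixP => i j; rewrite !ord1 mxE.
  (* At [u = 0] the whole cone is orthogonal to [u], so the test vector 1 forces [z = 0]. *)
  have := tz 1%:M; rewrite dot1 mxE mulr1; apply; split.
    by rewrite /nonneg_cone /= mxE ler01.
  by move=> _ ->; rewrite dot1 u0 mulr0.
have u_gt0 : 0 < u 0 0 by rewrite lt_def u_neq0.
(* With this scale [c *: u] has entry [1 + |z|], which dominates both [z] and [- z]; the 1 keeps the
   scale positive. *)
have c_gt0 : 0 < (1 + `|z 0 0|) / u 0 0 by rewrite divr_gt0// ltr_pwDl.
apply: (tan_prime_scaled_interior cQ _ c_gt0).
- by rewrite inE.
- rewrite /nonneg_cone /= !mxE divfK// -addrA addr_ge0//.
  by rewrite -lerBlDr sub0r -normrN ler_norm.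
- by rewrite /nonneg_cone /= !mxE divfK// -addrA addr_ge0// subr_ge0 ler_norm.
Qed.

(** * Geometry of the Lorentz cone: self-duality and convexity *)

Definition tail (R : realType) (n : nat) (x : 'cV[R]_n.+1) : 'cV[R]_n :=
  \col_(i < n) x (lift ord0 i) 0.

Lemma dot_tail (R : realType) (n : nat) (x y : 'cV[R]_n.+1) :
  dot x y = x 0 0 * y 0 0 + dot (tail x) (tail y).
Proof.
by rewrite /dot big_ord_recl; congr (_ + _); apply: eq_bigr => i _; rewrite !mxE.
Qed.

(** Membership without square roots, so that later inequalities are linear in monomials. *)
Lemma lorentz_coneP (R : realType) (n : nat) (x : 'cV[R]_n.+1) :
  lorentz_cone x <-> 0 <= x 0 0 /\ dot (tail x) (tail x) <= x 0 0 ^+ 2.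
Proof.
rewrite /lorentz_cone /= -/(tail x); split=> [Qx|[x0 Qx]].
- have x0 := le_trans (norm2_ge0 _) Qx; split => //.
  by rewrite -sqr_norm2 lerXn2r// nnegrE norm2_ge0.
- by rewrite -(ler_pXn2r (n := 2))// ?nnegrE ?norm2_ge0// sqr_norm2.
Qed.

Lemma tailD (R : realType) (n : nat) (x y : 'cV[R]_n.+1) :
  tail (x + y) = tail x + tail y.
Proof. by apply/matrixP => i j; rewrite !mxE. Qed.

Lemma tailZ (R : realType) (n : nat) (c : R) (x : 'cV[R]_n.+1) :
  tail (c *: x) = c *: tail x.
Proof. by apply/matrixP => i j; rewrite !mxE. Qed.

Lemma Jmx_head (R : realType) (n : nat) (x : 'cV[R]_n.+1) :
  (Jmx R n *m x) 0 0 = x 0 0.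
Proof. by rewrite mul_diag_mx !mxE mul1r. Qed.

Lemma tail_Jmx (R : realType) (n : nat) (x : 'cV[R]_n.+1) :
  tail (Jmx R n *m x) = - tail x.
Proof. by apply/matrixP => i j; rewrite mul_diag_mx !mxE /= mulN1r. Qed.

Lemma dotNN (R : realType) (n : nat) (x y : 'cV[R]_n) :
  dot (- x) (- y) = dot x y.
Proof. by apply: eq_bigr => i _; rewrite !mxE mulrNN. Qed.

Lemma Jmx_lorentz (R : realType) (n : nat) (x : 'cV[R]_n.+1) :
  lorentz_cone x -> lorentz_cone (Jmx R n *m x).
Proof. by rewrite !lorentz_coneP Jmx_head tail_Jmx dotNN. Qed.

Lemma head_tail_eq0 (R : realType) (n : nat) (x : 'cV[R]_n.+1) :
  x 0 0 = 0 -> tail x = 0 -> x = 0.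
Proof.
move=> x0 tx0; apply/matrixP => i j; rewrite ord1 mxE.
case: (unliftP ord0 i) => [k ->|-> //].
by have /matrixP/(_ k 0) := tx0; rewrite !mxE.
Qed.

Lemma lorentz_head0 (R : realType) (n : nat) (x : 'cV[R]_n.+1) :
  lorentz_cone x -> x 0 0 = 0 -> x = 0.
Proof.
move=> /lorentz_coneP[_ Qx] x0; apply: head_tail_eq0 => //; apply: dot_eq0.
by apply/eqP; rewrite eq_le dot_ge0 andbT (le_trans Qx)// x0 expr0n.
Qed.

(* Gives both self-duality of the cone and, when [dot x y = 0], the
   proportionality of [y] and [J x]. *)
Lemma lorentz_dot_lower_bound (R : realType) (n : nat) (x y : 'cV[R]_n.+1) :
  lorentz_cone x -> lorentz_cone y ->
  dot (y 0 0 *: tail x + x 0 0 *: tail y) (y 0 0 *: tail x + x 0 0 *: tail y)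
    <= 2 * (x 0 0 * y 0 0) * dot x y.
Proof.
move=> /lorentz_coneP[x0 Qx] /lorentz_coneP[y0 Qy].
rewrite dotDr !dotZr ![dot (_ + _) _]dotC !dotDr !dotZr dot_tail.
rewrite [dot (tail y) (tail x)]dotC.
(* The two square terms are each at most [x 0 0 ^+ 2 * y 0 0 ^+ 2]; the cross term matches
   exactly. *)
have := ler_wpM2l (sqr_ge0 (y 0 0)) Qx.
have := ler_wpM2l (sqr_ge0 (x 0 0)) Qy.
move: (dot _ _) (dot _ _) (dot _ _) => a b c; lra.
Qed.

Lemma lorentz_dual (R : realType) (n : nat) (x y : 'cV[R]_n.+1) :
  lorentz_cone x -> lorentz_cone y -> 0 <= dot x y.
Proof.
move=> Qx Qy; have key := le_trans (dot_ge0 _) (lorentz_dot_lower_bound Qx Qy).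
have [x0 _] := (lorentz_coneP x).1 Qx; have [y0 _] := (lorentz_coneP y).1 Qy.
have zero (v : 'cV[R]_n.+1) : dot v 0 = 0 by rewrite -(scale0r 0) dotZr mul0r.
(* Dividing the bound by [x 0 0 * y 0 0] needs nonzero heads; a cone vector with zero head is
   zero. *)
have [x00|x_neq0] := eqVneq (x 0 0) 0.
  by rewrite (lorentz_head0 Qx x00) dotC zero.
have [y00|y_neq0] := eqVneq (y 0 0) 0.
  by rewrite (lorentz_head0 Qy y00) zero.
by move: key; rewrite pmulr_rge0// !mulr_gt0// lt_def ?x_neq0 ?y_neq0.
Qed.

Lemma lorentz_convex (R : realType) (n : nat) : convex_cone (@lorentz_cone R n).
Proof.
split=> [x y Qx Qy|c x c0 /lorentz_coneP[x0 Qx]].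
(* Self-duality against [J y] bounds the cross term: [dot (tail x) (tail y) <= x 0 0 * y 0 0]. *)
- have := lorentz_dual Qx (Jmx_lorentz Qy).
  rewrite dot_tail Jmx_head tail_Jmx -scaleN1r dotZr mulN1r subr_ge0 => CS.
  move: Qx Qy => /lorentz_coneP[x0 Qx] /lorentz_coneP[y0 Qy].
  apply/lorentz_coneP; rewrite tailD mxE; split; first exact: addr_ge0.
  rewrite dotDr ![dot (_ + _) _]dotC !dotDr [dot (tail y) (tail x)]dotC.
  by move: (dot _ _) (dot _ _) (dot _ _) CS Qx Qy => a b c; lra.
- apply/lorentz_coneP; rewrite tailZ mxE; split; first exact: mulr_ge0.
  by rewrite dotZr dotC dotZr mulrA -expr2 exprMn ler_wpM2l// sqr_ge0.
Qed.

(** * Action of the matrices [S_ab] *)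

Lemma mul_Smx (R : realType) (n : nat) (a b : 'I_n) (x : 'cV[R]_n) :
  Smx R a b *m x = x b 0 *: delta_mx a 0 - x a 0 *: delta_mx b 0.
Proof.
have mul_delta (i j : 'I_n) : delta_mx i j *m x = x j 0 *: delta_mx i 0.
  rewrite -(mul_delta_mx (0 : 'I_1)) -mulmxA -rowE [row j x]mx11_scalar mxE.
  by rewrite mul_mx_scalar.
by rewrite mulmxBl !mul_delta.
Qed.

Lemma dot_Smx (R : realType) (n : nat) (a b : 'I_n) (x y : 'cV[R]_n) :
  dot y (Smx R a b *m x) = x b 0 * y a 0 - x a 0 * y b 0.
Proof. by rewrite mul_Smx dotBr !dotZr !dot_delta. Qed.

(* Orthogonal vectors [x, y] of the cone have [y] and [J x] proportional, so
   the 2x2 minors computed by the [S_ab] vanish. *)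
Lemma lorentz_mxs_orth (R : realType) (n : nat) (A : 'M[R]_n.+1)
    (x y : 'cV[R]_n.+1) :
  A \in lorentz_mxs R n -> lorentz_cone x -> lorentz_cone y ->
  dot y x = 0 -> dot y (A *m x) = 0.
Proof.
move=> ARs Qx Qy yx0.
have : dot (x 0 0 *: tail y + y 0 0 *: tail x)
           (x 0 0 *: tail y + y 0 0 *: tail x) = 0.
  apply/eqP; rewrite eq_le dot_ge0 andbT.
  by have := lorentz_dot_lower_bound Qy Qx; rewrite yx0 mulr0.
move=> /dot_eq0 d0; move: ARs; rewrite in_fsetU in_fset1 => /orP[/eqP->|].
  by rewrite mul1mx.
move=> /imfsetP[[a b] _ ->] /=; rewrite -mulmxA dot_Smx.
have prop i : x 0 0 * y i 0 = y 0 0 * (Jmx R n *m x) i 0.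
  case: (unliftP ord0 i) => [k ->|->]; last by rewrite Jmx_head mulrC.
  have /matrixP/(_ k 0) := d0; have /matrixP/(_ k 0) := tail_Jmx x.
  rewrite !mxE => ->; lra.
have [y00|y_neq0] := eqVneq (y 0 0) 0.
  by rewrite (lorentz_head0 Qy y00) !mxE !mulr0 subrr.
(* After multiplication by [y 0 0], [prop] turns both products into [x 0 0 * y a 0 * y b 0]. *)
apply: (mulfI y_neq0); rewrite mulrBr !mulrA -!prop mulr0; lra.
Qed.

(** The matrix set only has [a < b]; antisymmetry moves the sign into [c] for [a > b], and
    [S_aa = 0]. Sums over all pairs are thus allowed. *)
Lemma tan_prime_scaled_Smx (R : realType) (n : nat) (u : 'cV[R]_n.+1)
    (a b : 'I_n.+1) (c : R) :
  lorentz_cone u ->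
  tan_prime_scaled (@lorentz_cone R n) (lorentz_mxs R n) u
    (c *: (Smx R a b *m (Jmx R n *m u))).
Proof.
move=> Qu; have cQ := lorentz_convex R n.
have SRs (i j : 'I_n.+1) : (i < j)%N ->
    Smx R i j *m Jmx R n \in lorentz_mxs R n.
  move=> ij; rewrite in_fsetU; apply/orP; right.
  by apply/imfsetP; exists (i, j).
rewrite mulmxA; case: (ltngtP a b) => [ab|ba|/val_inj->].
- by apply: tan_prime_scaled_face => //; exact: SRs.
- rewrite -[Smx R a b]opprB !mulNmx scalerN -scaleNr.
  by apply: tan_prime_scaled_face => //; exact: SRs.
- by rewrite /Smx subrr !mul0mx scaler0; exact: tan_prime_scaled0.
Qed.

Lemma sum_delta (R : realType) (n : nat) (x : 'cV[R]_n) :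
  \sum_a x a 0 *: delta_mx a 0 = x.
Proof.
by rewrite [RHS]matrix_sum_delta; apply: eq_bigr => a _; rewrite big_ord1.
Qed.

(* The antisymmetric matrix [(z x^T - x z^T) / |x|^2] maps [x] to [z]. *)
Lemma orth_sum_Smx (R : realType) (n : nat) (x z : 'cV[R]_n) :
  dot x x != 0 -> dot z x = 0 ->
  z = \sum_a \sum_b (z a 0 * x b 0 / dot x x) *: (Smx R a b *m x).
Proof.
move=> xx_neq0 zx0.
have inner a : \sum_b (z a 0 * x b 0 / dot x x) *: (Smx R a b *m x) =
    z a 0 *: delta_mx a 0 - (z a 0 * x a 0 / dot x x) *: x.
  rewrite -[X in _ - _ *: X]sum_delta scaler_sumr.
  rewrite -[X in X *: _ - _](mulfK xx_neq0) mulrAC.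
  rewrite [X in (_ * X) *: _ - _]/dot mulr_sumr scaler_suml -sumrB.
  apply: eq_bigr => b _; rewrite mul_Smx scalerBr !scalerA.
  by congr (_ *: _ - _ *: _); ring.
under eq_bigr do rewrite inner.
(* The correction terms add up to [(dot z x / dot x x) *: x], which is zero. *)
rewrite sumrB sum_delta -scaler_suml -mulr_suml -/(dot z x) zx0.
by rewrite mul0r scale0r subr0.
Qed.

(** * Tangent vectors of the Lorentz cone *)

Lemma lorentz_norm2_tail (R : realType) (n : nat) (x : 'cV[R]_n.+1) :
  norm2 (tail x) <= x 0 0 -> lorentz_cone x.
Proof. by []. Qed.

(* [c u + z = c (u - d e0) + (c d e0 + z)] with [d = u0 - |u'|]. *)
Lemma lorentz_interior (R : realType) (n : nat) (u z : 'cV[R]_n.+1) (c : R) :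
  0 <= c -> norm2 (tail u) <= u 0 0 ->
  norm2 (tail z) - z 0 0 <= c * (u 0 0 - norm2 (tail u)) ->
  lorentz_cone (c *: u + z).
Proof.
move=> c0 Qu Qc; have [QD QZ] := lorentz_convex R n.
set d := u 0 0 - norm2 (tail u).
have tail_e0 : tail (delta_mx 0 0) = 0 :> 'cV[R]_n.
  by apply/matrixP => i j; rewrite !mxE.
have -> : c *: u + z =
    c *: (u + (- d) *: delta_mx 0 0) + ((c * d) *: delta_mx 0 0 + z).
  by rewrite scalerDr scalerA mulrN scaleNr addrA subrK.
apply: QD; last first.
  apply: lorentz_norm2_tail.
  rewrite tailD tailZ tail_e0 scaler0 add0r !mxE /= mulr1.
  by rewrite -lerBlDr.
apply: QZ => //; apply: lorentz_norm2_tail.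
by rewrite tailD tailZ tail_e0 scaler0 addr0 !mxE /= mulr1 opprB addrC subrK.
Qed.

Lemma tailN (R : realType) (n : nat) (x : 'cV[R]_n.+1) :
  tail (- x) = - tail x.
Proof. by apply/matrixP => i j; rewrite !mxE. Qed.

(** Two test vectors suffice: [e0] kills the head of [z], and then [N *: e0 + z], a boundary point,
    gives [dot (tail z) (tail z) = 0]. *)
Lemma lorentz_dual_eq0 (R : realType) (n : nat) (z : 'cV[R]_n.+1) :
  (forall y, lorentz_cone y -> dot z y = 0) -> z = 0.
Proof.
move=> z_orth; set N := norm2 (tail z).
pose e0 : 'cV[R]_n.+1 := delta_mx 0 0.
have tail_e0 : tail e0 = 0 by apply/matrixP => i j; rewrite !mxE.
have z00 : z 0 0 = 0.
  rewrite -dot_delta z_orth//; apply/lorentz_coneP.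
  by rewrite mxE eqxx -/e0 tail_e0 -(scale0r 0) dotZr mul0r sqr_ge0 ler01.
apply: head_tail_eq0 => //; apply: dot_eq0.
rewrite -[RHS](z_orth (N *: e0 + z)); last first.
  apply: lorentz_norm2_tail; rewrite tailD tailZ tail_e0 scaler0 add0r.
  by rewrite !mxE z00 mulr1 addr0.
by rewrite dotDr dotZr dot_delta z00 mulr0 add0r [RHS]dot_tail z00 mulr0 add0r.
Qed.

Lemma tan_space_lorentz (R : realType) (n : nat) (u z : 'cV[R]_n.+1) :
  lorentz_cone u -> tan_space (@lorentz_cone R n) u z ->
  tan_prime_scaled (@lorentz_cone R n) (lorentz_mxs R n) u z.
Proof.
move=> Qu tz; have cQ := lorentz_convex R n.
have [d_gt0|] := ltP (norm2 (tail u)) (u 0 0).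
  have N_ge0 := norm2_ge0 (tail z).
  have N_opp : norm2 (tail (- z)) = norm2 (tail z).
    by rewrite tailN /norm2 dotNN.
  (* Chosen so that [c] times the gap [u 0 0 - norm2 (tail u)] meets the requirement of
     [lorentz_interior] for both [z] and [- z]. *)
  pose c := (1 + `|z 0 0| + norm2 (tail z)) / (u 0 0 - norm2 (tail u)).
  have c_gt0 : 0 < c.
    by rewrite divr_gt0 ?subr_gt0// ltr_wpDr// ltr_pwDl.
  have cE : c * (u 0 0 - norm2 (tail u)) = 1 + `|z 0 0| + norm2 (tail z).
    by rewrite divfK// subr_eq0 gt_eqF.
  have z_le := ler_norm (z 0 0); have := ler_norm (- z 0 0).
  rewrite normrN => zN_le.
  apply: (tan_prime_scaled_interior cQ _ c_gt0).
  - by rewrite in_fsetU in_fset1 eqxx.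
  - by apply: lorentz_interior; rewrite ?cE ?ltW//; lra.
  - by apply: lorentz_interior; rewrite ?cE ?N_opp ?mxE ?ltW//; lra.
move=> u_le; set x := Jmx R n *m u.
have [xx0|xx_neq0] := eqVneq (dot x x) 0.
  have u0 : u = 0.
    by apply: (lorentz_head0 Qu); rewrite -Jmx_head -/x (dot_eq0 xx0) mxE.
  suff -> : z = 0 by exact: tan_prime_scaled0.
  apply: lorentz_dual_eq0 => y Qy; apply: tz; split => // _ ->.
  by rewrite u0 -(scale0r 0) dotZr mul0r.
(* On the boundary [J u] lies in the cone and is orthogonal to [u], since [dot (J u) u] is
   [u 0 0 ^+ 2 - norm2 (tail u) ^+ 2]; so [z] must be orthogonal to it. *)
have zx0 : dot z x = 0.
  apply: tz; split; first exact: Jmx_lorentz.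
  move=> _ ->; rewrite dotC dot_tail Jmx_head tail_Jmx -scaleN1r dotZr mulN1r.
  rewrite -sqr_norm2 -expr2; apply/eqP; rewrite subr_eq0.
  by rewrite (@le_anti _ _ (u 0 0) (norm2 (tail u))) ?u_le.
rewrite (orth_sum_Smx xx_neq0 zx0).
apply: (big_ind (tan_prime_scaled (@lorentz_cone R n) (lorentz_mxs R n) u)).
- exact: tan_prime_scaled0.
- by move=> ? ?; exact: tan_prime_scaledD.
move=> a _.
apply: (big_ind (tan_prime_scaled (@lorentz_cone R n) (lorentz_mxs R n) u)).
- exact: tan_prime_scaled0.
- by move=> ? ?; exact: tan_prime_scaledD.
by move=> b _; exact: tan_prime_scaled_Smx.
Qed.

(** Reduces (b) to [gamma = 1]. *)
Lemma tan_spaceZ (R : realType) (n : nat) (Q : set 'cV[R]_n) (u z : 'cV[R]_n)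
    (c : R) : tan_space Q u z -> tan_space Q u (c *: z).
Proof. by move=> tz y /tz zy0; rewrite dotC dotZr dotC zy0 mulr0. Qed.

Theorem proposition3p2 (R : realType) (n : nat) (Q : set 'cV[R]_n)
    (Rs : {fset 'M[R]_n}) (hQ : cone_with_mxs Q Rs)
    (u : 'cV[R]_n) (hu : Q u) :
  tan_prime Q Rs u `<=` tan_space Q u /\
  (forall (z : 'cV[R]_n) (gamma : R),
     tan_space Q u z -> 0 < gamma ->
     exists M : R, 0 < M /\ tan_prime Q Rs (M *: u) (gamma *: z)).
Proof.
case: hQ u hu => [|m _] u Qu; split.
- apply: tan_prime_sub => [x y Qx Qy|A x y].
    by rewrite dot1; exact: mulr_ge0.
  by rewrite in_fset1 => /eqP-> _ _; rewrite mul1mx.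
- by move=> z gamma tz _; apply: tan_space_nonneg => //; exact: tan_spaceZ.
- by apply: tan_prime_sub; [exact: lorentz_dual | exact: lorentz_mxs_orth].
- by move=> z gamma tz _; apply: tan_space_lorentz => //; exact: tan_spaceZ.
Qed.
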